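(* Let $r=r(n)$ and let $p=p(n)=\omega\left(\binom{n-r}{r}^{-1/2}\right)$. Then almost surely $$\limsup_{n\to\infty}q^*(G_p(n,r,0))\le\limsup_{n\to\infty}\frac{r}{n-r}.$$
   Context: For integers $n,r,s$, the Johnson graph $G(n,r,s)$ has as vertices all vectors $v\in\{0,1\}^n$ with exactly $r$ ones; two vertices are joined by an edge if and only if their inner product equals $s$. Here the parameters are such that the graph $G(n,r,0)$ has edges, i.e. $n\ge 2r$ and $r\geq 1$. For $p\in[0,1]$, $G_p(n,r,s)$ is the random graph obtained from $G(n,r,s)$ by removing every edge with probability $1-p$ independently of all other edges. The random graphs of the sequence are regarded as defined on a common probability space. Modularity: for a graph $G$ with $e(G)$ edges and a partition $\mathcal{A}$ of its vertex set, $q(\mathcal{A})=\sum_{A\in\mathcal{A}}\frac{e(A)}{e(G)}-\sum_{A\in\mathcal{A}}\frac{(\sum_{v\in A}\deg(v))^2}{4e(G)^2}$, where $e(A)$ is the number of edges of $G$ with both endpoints in $A$. The modularity of $G$ is $q^*(G)=\max_{\mathcal{A}}q(\mathcal{A})$, over all partitions of the vertex set. $f=\omega(g)$ means $f(n)/g(n)\to\infty$ as $n\to\infty$. *)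

(* Defs.v *)
From HB Require Import structures.
From mathcomp Require Import all_boot all_order all_algebra.

Set Implicit Arguments.
Unset Strict Implicit.
Unset Printing Implicit Defensive.

Import Order.TTheory GRing.Theory Num.Theory.
Local Open Scope ring_scope.

Section JohnsonGraph.
Variables n r s : nat.

Definition johnson_vertex : Type :=
  {v : {ffun 'I_n -> bool} | (\sum_(i < n) v i == r)%N}.

HB.instance Definition _ := Finite.on johnson_vertex.

Definition inner_product (u v : johnson_vertex) : nat :=
  (\sum_(i < n) val u i * val v i)%N.

Definition johnson_adj : rel johnson_vertex :=
  fun u v => (u != v) && (inner_product u v == s).

(* An edge is encoded as the two-element set of its endpoints. *)
Definition johnson_edges : {set {set johnson_vertex}} :=
  [set e : {set johnson_vertex} |
    [exists u, exists v, johnson_adj u v && (e == [set u; v])]].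

End JohnsonGraph.

(* A simple graph on the vertex set V is given by its edge set E, a set of
   two-element subsets of V. *)
Section Modularity.
Variables (R : realFieldType) (V : finType) (E : {set {set V}}).

Definition edges_within (A : {set V}) : {set {set V}} :=
  [set e in E | e \subset A].

Definition degree (v : V) : nat := #|[set e in E | v \in e]|.

(* If E is empty this is 0, because division by 0 yields 0. *)
Definition partition_modularity (P : {set {set V}}) : R :=
  \sum_(A in P) #|edges_within A|%:R / #|E|%:R
  - \sum_(A in P) (\sum_(v in A) (degree v)%:R) ^+ 2 / (4 * #|E|%:R ^+ 2).

(* The partition into singletons only serves as the initial value of the
   iterated maximum; since it is a partition, the result is the maximum over
   all partitions (see modularity_attained and modularity_ge). *)
Definition singletons : {set {set V}} := [set [set v] | v : V].

Definition modularity : R :=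
  \big[Num.max/partition_modularity singletons]_(P : {set {set V}} |
    partition P [set: V]) partition_modularity P.

Lemma singletons_partition : partition singletons [set: V].
Proof.
apply/and3P; split.
- rewrite eqEsubset subsetT /=; apply/subsetP => v _.
  by apply/bigcupP; exists [set v]; rewrite ?set11 // imset_f.
- apply/trivIsetP => _ _ /imsetP[u _ ->] /imsetP[v _ ->] uv.
  by rewrite disjoints1 inE; apply: contraNneq uv => ->.
- by apply/imsetP => -[v _ /setP/(_ v)]; rewrite !inE eqxx.
Qed.

Lemma modularity_attained :
  exists2 P : {set {set V}},
    partition P [set: V] & modularity = partition_modularity P.
Proof.
rewrite /modularity.
elim/big_ind: _ => [|x y [P Pp ->] [Q Qp ->]|P Pp].
- by exists singletons => //; exact: singletons_partition.
- by rewrite maxEle; case: ifP => _; [exists Q | exists P].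
- by exists P.
Qed.

Lemma modularity_ge (P : {set {set V}}) :
  partition P [set: V] -> partition_modularity P <= modularity.
Proof. by move=> Pp; rewrite /modularity; apply: le_bigmax_cond. Qed.

End Modularity.

From mathcomp Require Import all_classical all_reals all_analysis.
Import numFieldNormedType.Exports.
Local Open Scope classical_set_scope.

Section RandomGraph.
Context {d : measure_display} {T : measurableType d} {R : realType}.
Variable P : probability T R.

(* G is obtained from the graph with edge set E by keeping every edge with
   probability p (removing it with probability 1 - p), the events that the
   various edges are kept being mutually independent. *)
Definition is_random_subgraph (V : finType) (E : {set {set V}}) (p : R)
    (G : T -> {set {set V}}) : Prop :=
  [/\ forall w, G w \subset E,
      forall e, e \in E -> measurable [set w | e \in G w],
      forall e, e \in E -> P [set w | e \in G w] = p%:E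
    & forall J : {set {set V}}, J \subset E ->
        P [set w | forall e, e \in J -> e \in G w]
        = (\prod_(e in J) P [set w | e \in G w])%E].

End RandomGraph.

(* f = omega(g) *)
Definition little_omega {R : realType} (f g : nat -> R) : Prop :=
  f n / g n @[n --> \oo] --> +oo.

(* Main.v *)
(** Write N for the number of vertices of the Kneser graph, D = C(n-r, r) for
    its degree and rho = r / (n-r).

    Inclusion-exclusion shows that the adjacency operator S maps the indicator
    of {u | x \subset u} into the span of the indicators for y \subset x, with
    diagonal coefficient (-1)^j C(n-r-j, r-j), j = #|x|.  Hence on the
    complement of the constants S is annihilated by the product over
    1 <= j <= r of S - (-1)^j C(n-r-j, r-j), and, being symmetric, it has there
    no eigenvalue above C(n-r-1, r-1) = rho D.  So a partition whose blocks have
    square sum s N^2 contains at most (s + rho (1 - s)) N D / 2 edges, while its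
    degree tax is s: its modularity is at most rho in the full graph.

    This survives the sparsification once all degrees are at least
    (1 - eps) p D and, for each of the at most N^N partitions, the number of
    inner edges exceeds its mean by at most eps p N D / 2.  By Chernoff's bound
    both hold outside an event of probability O(N^-2) as soon as p D dominates
    ln N; this follows from the hypothesis on p because ln N <= 4 sqrt D when
    n >= 2r + 2.  Borel-Cantelli concludes; for n <= 2r + 1 the ratio rho is
    already within 2 / (n + 1) of 1. *)

From HB Require Import structures.
Require Import Defs.
From mathcomp Require Import all_boot all_order all_algebra.
From mathcomp Require Import zify ring lra.
Import Order.TTheory GRing.Theory Num.Theory.

Set Implicit Arguments.
Unset Strict Implicit.
Unset Printing Implicit Defensive.

Local Open Scope ring_scope.

(** * Rayleigh quotients of symmetric kernels *)
Section SymmetricOperator.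
Variables (R : realFieldType) (V : finType) (a : V -> V -> R).
Hypothesis a_sym : forall u v, a u v = a v u.
Implicit Types f g : {ffun V -> R^o}.

Definition dotf f g : R := \sum_v f v * g v.

Definition kernel_op f : {ffun V -> R^o} := [ffun u => \sum_v a u v * f v].

Lemma dotfC f g : dotf f g = dotf g f.
Proof. by apply: eq_bigr => v _; rewrite mulrC. Qed.

Lemma dotfDl f g h : dotf (f + g) h = dotf f h + dotf g h.
Proof. by rewrite -big_split; apply: eq_bigr => v _; rewrite ffunE mulrDl. Qed.

Lemma dotfZl c f g : dotf (c *: f) g = c * dotf f g.
Proof. by rewrite mulr_sumr; apply: eq_bigr => v _; rewrite ffunE -mulrA. Qed.

Lemma dotfDr f g h : dotf h (f + g) = dotf h f + dotf h g.
Proof. by rewrite dotfC dotfDl !(dotfC h). Qed.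

Lemma dotfZr c f g : dotf g (c *: f) = c * dotf g f.
Proof. by rewrite dotfC dotfZl (dotfC g). Qed.

Lemma dotf_suml I (s : seq I) (F : I -> {ffun V -> R^o}) g :
  dotf (\sum_(i <- s) F i) g = \sum_(i <- s) dotf (F i) g.
Proof.
elim: s => [|i s IH]; last by rewrite !big_cons dotfDl IH.
by rewrite !big_nil /dotf big1 // => v _; rewrite ffunE mul0r.
Qed.

Lemma dotf_sumr I (s : seq I) (F : I -> {ffun V -> R^o}) g :
  dotf g (\sum_(i <- s) F i) = \sum_(i <- s) dotf g (F i).
Proof. by rewrite dotfC dotf_suml; apply: eq_bigr => i _; rewrite dotfC. Qed.

Lemma dotf_ge0 f : 0 <= dotf f f.
Proof. by apply: sumr_ge0 => v _; rewrite -expr2 sqr_ge0. Qed.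

Lemma dotf_eq0 f : dotf f f = 0 -> f = 0.
Proof.
move=> /eqP; rewrite psumr_eq0 => [|v _]; last by rewrite -expr2 sqr_ge0.
move=> /allP f0; apply/ffunP => v; rewrite ffunE; apply/eqP.
by have := f0 v (mem_index_enum v); rewrite -expr2 sqrf_eq0.
Qed.

Lemma kernel_opP c f g : kernel_op (c *: f + g) = c *: kernel_op f + kernel_op g.
Proof.
apply/ffunP => u; rewrite !ffunE scaler_sumr -big_split; apply: eq_bigr => v _.
by rewrite !ffunE mulrDr /= /GRing.scale /=; ring.
Qed.

HB.instance Definition _ :=
  GRing.isLinear.Build R {ffun V -> R^o} {ffun V -> R^o} *:%R kernel_op
    kernel_opP.

Lemma kernel_op_sym f g : dotf (kernel_op f) g = dotf f (kernel_op g).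
Proof.
rewrite /dotf; under eq_bigr => u _ do rewrite ffunE mulr_suml.
under [RHS]eq_bigr => v _ do rewrite ffunE mulr_sumr.
rewrite exchange_big; apply: eq_bigr => v _; apply: eq_bigr => u _.
by rewrite (a_sym u v); ring.
Qed.

Definition shift_op (m : R) f : {ffun V -> R^o} := kernel_op f - m *: f.

Lemma shift_op_sym m f g : dotf (shift_op m f) g = dotf f (shift_op m g).
Proof.
rewrite /shift_op -!scaleNr dotfDl dotfDr kernel_op_sym.
by rewrite dotfZl dotfZr.
Qed.

(** Induction on [s]: the shifted function splits into eigenvectors, dividing the component for [x]
    by [x - m] undoes the shift when [x != m], and symmetry rules out a Jordan block at [m]. *)
Lemma eigen_decomposition (s : seq R) f :
  foldl (fun g m => shift_op m g) f s = 0 ->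
  exists l : seq R, exists g : R -> {ffun V -> R^o},
    [/\ uniq l, {subset l <= s}, f = \sum_(m <- l) g m
      & forall m, m \in l -> kernel_op (g m) = m *: g m].
Proof.
elim: s f => [|m s IH] f /=.
  by move=> ->; exists [::], (fun=> 0); split => //; rewrite big_nil.
move=> /IH[l [g [ul sl fE gE]]].
pose l' := [seq x <- l | x != m].
pose g0 := if m \in l then g m else 0.
(* What is left of [f] after removing these preimages will be its component for [m]. *)
pose h := f - \sum_(x <- l') (x - m)^-1 *: g x.
have shl x : x \in l -> x != m -> shift_op m ((x - m)^-1 *: g x) = g x.
  move=> xl xm; rewrite /shift_op linearZ /= gE // !scalerA -scalerBl.
  have -> : (x - m)^-1 * x - m * (x - m)^-1 = 1; last by rewrite scale1r.
  by rewrite [m * _]mulrC -mulrBr mulVf // subr_eq0.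
have hE : shift_op m h = g0.
  have lin u v : shift_op m (u - v) = shift_op m u - shift_op m v.
    by rewrite /shift_op linearB /= scalerBr opprD addrACA -opprD.
  rewrite lin fE.
  have -> : shift_op m (\sum_(x <- l') (x - m)^-1 *: g x) = \sum_(x <- l') g x.
    rewrite /shift_op linear_sum scaler_sumr -sumrB !big_seq.
    apply: eq_bigr => x; rewrite mem_filter => /andP[xm xl].
    exact: shl.
  rewrite /g0 /l' big_filter.
  case: ifPn => ml; first by rewrite (bigD1_seq m) //= addrK.
  rewrite [X in _ - X]big_seq_cond [X in X - _]big_seq.
  rewrite [X in _ - X](eq_bigl (fun i => i \in l)) ?subrr // => x.
  by case: (boolP (x \in l)) => //= xl; apply: contraNneq ml => <-.
(* [g0] lies in both the image and the kernel of the symmetric [shift_op m], so it is orthogonal to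
   itself. *)
have g00 : g0 = 0.
  apply: dotf_eq0; rewrite -{2}hE -shift_op_sym.
  suff -> : shift_op m g0 = 0.
    by rewrite /dotf big1 // => v _; rewrite ffunE mul0r.
  rewrite /g0; case: ifP => ml; rewrite /shift_op.
      by rewrite gE // subrr.
    by rewrite [kernel_op 0]linear0 scaler0 subr0.
exists (m :: l'), (fun x => if x == m then h else (x - m)^-1 *: g x); split.
- by rewrite /= mem_filter eqxx filter_uniq.
- move=> x; rewrite !inE mem_filter => /predU1P[->|/andP[_ /sl ->]].
    by rewrite eqxx.
  by rewrite orbT.
- rewrite big_cons eqxx.
  rewrite [X in _ + X](_ : _ = \sum_(x <- l') (x - m)^-1 *: g x) ?subrK //.
  rewrite !big_seq; apply: eq_bigr => x.
  by rewrite mem_filter => /andP[/negPf ->].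
- move=> x; rewrite inE; case: eqVneq => [-> _|xm /=].
    by move/eqP: hE; rewrite g00 /shift_op subr_eq0 => /eqP.
  rewrite mem_filter => /andP[_ xl].
  by rewrite linearZ /= gE // !scalerA mulrC.
Qed.

(** Eigenvectors for distinct eigenvalues are orthogonal, so both sides become sums of
    [dotf (g m) (g m)], weighted by [m] and by [lam]. *)
Lemma rayleigh_le (s : seq R) (lam : R) f :
  (forall m, m \in s -> m <= lam) ->
  foldl (fun g m => shift_op m g) f s = 0 ->
  dotf f (kernel_op f) <= lam * dotf f f.
Proof.
move=> slam /eigen_decomposition[l [g [ul ls -> gE]]].
have ortho m k : m \in l -> k \in l -> m != k -> dotf (g m) (g k) = 0.
  move=> ml kl mk; have := kernel_op_sym (g m) (g k).
  rewrite !gE // dotfZl dotfZr => /eqP; rewrite -subr_eq0 -mulrBl mulf_eq0.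
  by rewrite subr_eq0 (negPf mk) => /eqP.
rewrite linear_sum /= !dotf_suml mulr_sumr big_seq [X in _ <= X]big_seq.
apply: ler_sum => m ml; rewrite !dotf_sumr !(bigD1_seq m) //=.
rewrite !big1_seq => [|k /andP[km kl]|k /andP[km kl]].
- rewrite !addr0 gE // dotfZr; apply: ler_wpM2r; first exact: dotf_ge0.
  exact/slam/ls.
- by rewrite ortho // eq_sym.
- by rewrite gE // dotfZr ortho ?mulr0 // eq_sym.
Qed.

End SymmetricOperator.

(** * The spectrum of the Kneser graph *)

Section Kneser.
Variables (n r : nat).
Local Notation V := (johnson_vertex n r).
Implicit Types (u v : V) (x y A : {set 'I_n}).

Definition supp u : {set 'I_n} := [set i | val u i].

Lemma card_supp u : #|supp u| = r.
Proof.
rewrite -(eqP (valP u)) -sum1_card big_mkcond /=.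
by apply: eq_bigr => i _; rewrite inE; case: (val u i).
Qed.

Lemma supp_inj : injective supp.
Proof.
move=> u v /setP uv; apply/val_inj/ffunP => i.
by have := uv i; rewrite !inE.
Qed.

Lemma supp_surj A : #|A| = r -> exists u, supp u = A.
Proof.
move=> Ar; pose f := [ffun i => i \in A].
have fr : (\sum_(i < n) f i == r)%N.
  rewrite -Ar -sum1_card [X in _ == X]big_mkcond; apply/eqP/eq_bigr => i _.
  by rewrite ffunE; case: (i \in A).
by exists (Sub f fr); apply/setP => i; rewrite inE SubK ffunE.
Qed.

Lemma card_vertex_pred (Q : pred {set 'I_n}) :
  #|[set v : V | Q (supp v)]| = #|[set A : {set 'I_n} | (#|A| == r) && Q A]|.
Proof.
rewrite -(card_imset _ supp_inj); apply: eq_card => A; rewrite inE.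
apply/imsetP/andP => [[v]|[/eqP /supp_surj[v <-] Qv]].
  by rewrite inE => Qv ->; rewrite card_supp.
by exists v => //; rewrite inE.
Qed.

Lemma card_johnson_vertex : #|{: V}| = 'C(n, r).
Proof.
rewrite -cardsT -[in RHS](card_ord n) -card_draws.
transitivity #|[set v : V | predT (supp v)]|; last rewrite card_vertex_pred.
  by apply: eq_card => v; rewrite !inE.
by apply: eq_card => A; rewrite !inE andbT.
Qed.

Lemma inner_productE u v : inner_product u v = #|supp u :&: supp v|.
Proof.
rewrite -sum1_card big_mkcond; apply: eq_bigr => i _.
by rewrite !inE; case: (val u i); case: (val v i).
Qed.

Lemma kneser_adjE u v : (0 < r)%N ->
  johnson_adj 0 u v = [disjoint supp u & supp v].
Proof.
move=> r0; rewrite /johnson_adj inner_productE cards_eq0 setI_eq0.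
case: eqVneq => [->|//]; apply/esym/negbTE.
by rewrite -setI_eq0 setIid -cards_eq0 card_supp -lt0n.
Qed.

(** Removing [x] from the support of [v] is a bijection onto the subsets of size [r - #|x|] of the
    complement of [supp u :|: x]. *)
Lemma card_disjoint_above u x : (#|x| <= r)%N -> [disjoint x & supp u] ->
  #|[set v : V | [disjoint supp u & supp v] && (x \subset supp v)]|
  = 'C(n - r - #|x|, r - #|x|).
Proof.
move=> xr dxu.
rewrite (card_vertex_pred (fun A => [disjoint supp u & A] && (x \subset A))).
have cardU : #|~: (supp u :|: x)| = (n - r - #|x|)%N.
  rewrite cardsCs setCK card_ord cardsU card_supp.
  by rewrite setIC (disjoint_setI0 dxu) cards0 subn0 subnDA.
rewrite -cardU -cards_draws.
have inj : {in [set B : {set 'I_n} | (B \subset ~: (supp u :|: x)) &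
    (#|B| == r - #|x|)%N] &, injective (fun B => B :|: x)}.
  move=> B C; rewrite !inE setCU !subsetI => /andP[/andP[_ Bx] _].
  move=> /andP[/andP[_ Cx] _] BC.
  have E (D : {set 'I_n}) : D \subset ~: x -> D = (D :|: x) :\: x.
    move=> Dx; rewrite setDUl setDv setU0; apply/esym/setDidPl.
    by rewrite disjoints_subset.
  by rewrite (E B) // (E C) // BC.
rewrite -(card_in_imset inj); apply: eq_card => A; rewrite inE.
apply/and3P/imsetP => [[/eqP Ar dA xA]|[B]].
  exists (A :\: x); last first.
    by rewrite setUC -[LHS](setID A x) (setIidPr xA).
  rewrite inE cardsD (setIidPr xA) Ar eqxx andbT.
  rewrite setCU subsetI -!disjoints_subset disjoint_sym.
  rewrite (disjointWr (subsetDl _ _) dA) /=.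
  by rewrite disjoints_subset setDE subsetIr.
rewrite inE setCU subsetI => /andP[/andP[Bu Bx] /eqP Br] ->.
rewrite -!disjoints_subset in Bu Bx.
rewrite cardsU (disjoint_setI0 Bx) cards0 subn0 Br subnK // eqxx subsetUr.
by rewrite -setI_eq0 setIUr !(setIC (supp u)) !disjoint_setI0 ?setU0.
Qed.

End Kneser.

(** Serves twice: with [t = -1] for inclusion-exclusion in the Kneser spectrum, and with general [t]
    for the moment generating function of a random subset. *)
Lemma prod_indicator_expand (R : comNzRingType) (I : finType) (F H : {set I})
    (t : R) :
  \prod_(i in F) (1 + t * (i \in H)%:R)
  = \sum_(J : {set I} | J \subset F) t ^+ #|J| * (J \subset H)%:R.
Proof.
have prod_in (J K : {set I}) :
    \prod_(i in J) (i \in K)%:R = (J \subset K)%:R :> R.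
  case: (boolP (J \subset K)) => [/subsetP JK|/subsetPn[i iJ iK]].
    by rewrite big1 // => i /JK ->.
  by rewrite (bigD1 i) //= (negPf iK) mul0r.
rewrite big_mkcond [RHS]big_mkcond /=.
under eq_bigr => i _.
  rewrite (_ : (if _ then _ else _) = (i \in F)%:R * (t * (i \in H)%:R) + 1).
    over.
  by case: (i \in F); rewrite ?mul1r ?mul0r ?add0r // addrC.
rewrite bigA_distr; apply: eq_bigr => J _.
rewrite -big_mkcond big_split /= big_split /= prodr_const !prod_in.
by case: (J \subset F); rewrite ?mul1r ?mul0r.
Qed.

Section KneserSpectrum.
Variables (R : realFieldType) (n r : nat).
Hypothesis r_gt0 : (0 < r)%N.
Hypothesis r2n : (2 * r <= n)%N.
Local Notation V := (johnson_vertex n r).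
Local Notation fspace := {ffun V -> R^o}.
Implicit Types (u v : V) (x y : {set 'I_n}) (f : fspace).

Definition kneser_kernel u v : R := (johnson_adj 0 u v)%:R.

Lemma kneser_kernel_sym u v : kneser_kernel u v = kneser_kernel v u.
Proof. by rewrite /kneser_kernel !kneser_adjE // disjoint_sym. Qed.

Definition incidence x : fspace := [ffun u => (x \subset supp u)%:R].

Definition kneser_eigenvalue j : R := (-1) ^+ j * 'C(n - r - j, r - j)%:R.

(** Since [incidence x] is the product of the coordinates in [x], these are the polynomials of
    degree at most [k] on the vertices. *)
Definition low_degree k : {vspace fspace} :=
  (\sum_(x : {set 'I_n} | (#|x| <= k)%N) <[incidence x]>)%VS.

Lemma incidence_low_degree k x : (#|x| <= k)%N -> incidence x \in low_degree k.
Proof. by move=> xk; rewrite memvE (sumv_sup x). Qed.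

(** All supports have size [r], so [incidence (supp u)] is the indicator of the single vertex
    [u]. *)
Lemma low_degree_full f : f \in low_degree r.
Proof.
have -> : f = \sum_u f u *: incidence (supp u).
  apply/ffunP => v; rewrite sum_ffunE (bigD1 v) //= big1 => [|u uv].
    by rewrite !ffunE subxx addr0 /GRing.scale /= mulr1.
  rewrite !ffunE; case: (boolP (_ \subset _)) => [uv'|_].
    case/eqP: uv; apply: supp_inj; apply/eqP.
    by rewrite eqEcard uv' !card_supp /=.
  by rewrite scaler0.
apply: memv_suml => u _; apply: memvZ.
by rewrite incidence_low_degree ?card_supp.
Qed.

(** The value at [u] counts the neighbours of [u] above [x]: none if [supp u] meets [x], a binomial
    coefficient otherwise. Expanding the product over [x] of one minus the coordinates of [u]
    encodes the two cases. *)
Lemma kneser_incidence x : (#|x| <= r)%N ->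
  kernel_op kneser_kernel (incidence x)
  = 'C(n - r - #|x|, r - #|x|)%:R
    *: \sum_(y : {set 'I_n} | y \subset x) (-1) ^+ #|y| *: incidence y.
Proof.
move=> xr; apply/ffunP => u; rewrite !ffunE sum_ffunE.
have -> : \sum_v kneser_kernel u v * incidence x v
    = #|[set v : V | [disjoint supp u & supp v] && (x \subset supp v)]|%:R.
  rewrite -sum1_card natr_sum [RHS]big_mkcond; apply: eq_bigr => v _.
  rewrite ffunE inE /kneser_kernel kneser_adjE //.
  by case: [disjoint _ & _]; case: (_ \subset _); rewrite ?(mul0r, mulr0, mulr1).
have <- : \prod_(i in x) (1 + (-1) * (i \in supp u)%:R)
    = \sum_(y : {set 'I_n} | y \subset x) ((-1) ^+ #|y| *: incidence y) u.
  by rewrite prod_indicator_expand; apply: eq_bigr => y _; rewrite !ffunE.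
case: (boolP [disjoint x & supp u]) => [dxu|].
  rewrite card_disjoint_above // big1 => [|i ix].
    by rewrite /GRing.scale /= mulr1.
  by rewrite (disjointFr dxu ix) mulr0 addr0.
rewrite -setI_eq0 => /set0Pn[i]; rewrite inE => /andP[ix iu].
rewrite (bigD1 i) //= iu mulr1 subrr mul0r scaler0.
rewrite (_ : [set v | _] = set0) ?cards0 //; apply/setP => v; rewrite !inE.
apply/negbTE/negP => /andP[duv /subsetP/(_ i ix) iv].
by rewrite (disjointFr duv iu) in iv.
Qed.

(** For [#|x| = k.+1] the shift cancels exactly the coefficient of [incidence x] in its own image;
    only proper subsets of [x] remain. *)
Lemma shift_low_degree k f : (k < r)%N -> f \in low_degree k.+1 ->
  shift_op kneser_kernel (kneser_eigenvalue k.+1) f \in low_degree k.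
Proof.
move=> kr /memv_sumP[g gP ->].
rewrite /shift_op linear_sum scaler_sumr -sumrB.
apply: memv_suml => x xk; have /vlineP[c ->] := gP x xk.
rewrite linearZ /= scalerA mulrC -scalerA -scalerBr memvZ //.
rewrite kneser_incidence ?(leq_trans xk) //.
rewrite (bigD1 x) //= scalerDr scalerA mulrC addrAC rpredD //.
  move: xk; rewrite leq_eqVlt => /predU1P[->|xk].
    by rewrite subrr mem0v.
  by rewrite rpredB // memvZ // incidence_low_degree.
apply: memvZ; apply: memv_suml => y /andP[yx nyx].
apply: memvZ; apply: incidence_low_degree.
by rewrite -ltnS (leq_trans _ xk) // proper_card // properEneq nyx.
Qed.

(** [foldl] consumes the head first, so [rev] makes the top degree go first. Index 0, the eigenvalue
    of the constants, is left out. *)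
Definition kneser_roots k : seq R :=
  [seq kneser_eigenvalue j | j <- rev (iota 1 k)].

Lemma foldl_shift_low_degree k f : (k <= r)%N -> f \in low_degree k ->
  foldl (fun g m => shift_op kneser_kernel m g) f (kneser_roots k)
    \in low_degree 0.
Proof.
elim: k f => // k IH f kr fk.
rewrite /kneser_roots -[k.+1]addn1 iotaD rev_cat /= add1n.
by apply: IH; [exact: ltnW | exact: shift_low_degree].
Qed.

Definition kneser_degree := 'C(n - r, r).

Lemma incidence0 : incidence set0 = [ffun=> 1].
Proof. by apply/ffunP => v; rewrite !ffunE sub0set. Qed.

Lemma kneser_op1 :
  kernel_op kneser_kernel [ffun=> 1] = kneser_degree%:R *: [ffun=> 1] :> fspace.
Proof.
rewrite -incidence0 kneser_incidence cards0 // !subn0; congr (_ *: _).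
by rewrite (big_pred1 set0) ?cards0 ?scale1r // => y; rewrite subset0.
Qed.

Lemma dotf1 f : dotf [ffun=> 1] f = \sum_v f v.
Proof. by apply: eq_bigr => v _; rewrite ffunE mul1r. Qed.

(** The successive shifts turn [f] into a constant while keeping it orthogonal to the constants, an
    invariant line; the result is therefore 0 and [rayleigh_le] applies. *)
Lemma kneser_rayleigh f : \sum_v f v = 0 ->
  dotf f (kernel_op kneser_kernel f) <= 'C(n - r - 1, r - 1)%:R * dotf f f.
Proof.
move=> f0; apply: (rayleigh_le kneser_kernel_sym (s := kneser_roots r)).
  move=> m /mapP[j]; rewrite mem_rev mem_iota add1n ltnS => /andP[j1 jr] ->.
  apply: (@le_trans _ _ 'C(n - r - j, r - j)%:R).
    rewrite /kneser_eigenvalue -[X in _ <= X]mul1r ler_wpM2r //.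
    by rewrite -signr_odd; case: (odd j); rewrite ?expr0 // expr1; lra.
  (* By Pascal's rule the absolute values do not increase with [j], so [j = 1] dominates. *)
  rewrite ler_nat; elim: j j1 jr => // -[|j] IH _ jr; first by [].
  apply: leq_trans (IH _ (ltnW jr)) => //.
  have -> : (n - r - j.+1 = (n - r - j.+2).+1)%N by lia.
  have -> : (r - j.+1 = (r - j.+2).+1)%N by lia.
  by rewrite binS leq_addl.
set g := foldl _ _ _.
have : g \in low_degree 0 by exact/foldl_shift_low_degree/low_degree_full.
rewrite /low_degree (big_pred1 set0) => [|x]; last by rewrite leqn0 cards_eq0.
move=> /vlineP[c]; rewrite incidence0 => gc.
apply: dotf_eq0; rewrite {1}gc dotfZl.
suff -> : dotf [ffun=> 1] g = 0 by rewrite mulr0.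
rewrite -dotf1 in f0; rewrite /g; elim: (kneser_roots r) f f0 {g gc} => //=.
move=> m s IH f f0; apply: IH.
rewrite -shift_op_sym; last exact: kneser_kernel_sym.
by rewrite /shift_op kneser_op1 -scalerBl dotfZl f0 mulr0.
Qed.

(** An expander mixing bound: [kneser_rayleigh] for the indicator of [A] minus its mean. Ordered
    pairs are counted, so every inner edge twice. *)
Lemma kneser_edges_within (A : {set V}) :
  \sum_(u in A) \sum_(v in A) kneser_kernel u v
  <= kneser_degree%:R * (#|A|%:R ^+ 2 / #|{: V}|%:R)
     + 'C(n - r - 1, r - 1)%:R * (#|A|%:R - #|A|%:R ^+ 2 / #|{: V}|%:R).
Proof.
have N0 : (#|{: V}|%:R : R) != 0.
  by rewrite card_johnson_vertex pnatr_eq0 -lt0n bin_gt0; lia.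
pose ind : fspace := [ffun v => (v \in A)%:R].
pose one : fspace := [ffun=> 1].
pose c : R := - (#|A|%:R / #|{: V}|%:R).
have op1 : kernel_op kneser_kernel one = kneser_degree%:R *: one.
  exact: kneser_op1.
have sum1A : dotf one ind = #|A|%:R.
  rewrite dotf1 -sum1_card natr_sum [RHS]big_mkcond.
  by apply: eq_bigr => v _; rewrite ffunE; case: (v \in A).
have sum11 : dotf one one = #|{: V}|%:R.
  rewrite dotf1 -sum1_card natr_sum.
  by apply: eq_bigr => v _; rewrite ffunE.
have indA : dotf ind ind = #|A|%:R.
  rewrite -sum1A dotf1; apply: eq_bigr => v _.
  by rewrite ffunE; case: (v \in A); rewrite ?mulr1 ?mulr0.
have SA : dotf ind (kernel_op kneser_kernel ind)
    = \sum_(u in A) \sum_(v in A) kneser_kernel u v.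
  rewrite [RHS]big_mkcond; apply: eq_bigr => u _; rewrite !ffunE.
  case: (u \in A); rewrite ?mul0r ?mul1r //.
  rewrite [RHS]big_mkcond; apply: eq_bigr => v _; rewrite ffunE.
  by case: (v \in A); rewrite ?mulr1 ?mulr0.
have := @kneser_rayleigh (ind + c *: one).
rewrite linearD linearZ /= op1.
rewrite !(dotfDl, dotfDr, dotfZl, dotfZr).
rewrite -(kernel_op_sym kneser_kernel_sym one ind).
rewrite op1 dotfZl (dotfC ind one) sum1A sum11 indA SA.
have -> : \sum_v (ind + c *: one) v = 0.
  rewrite -dotf1 dotfDr dotfZr sum1A sum11 /c mulNr divfK // subrr.
  by [].
move=> /(_ erefl).
set q := _ ^+ 2 / _; set X := \sum_(u in A) _ => H.
rewrite addrC -lerBlDr; apply: le_trans (_ : _ <= _) (le_trans H _).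
  by rewrite le_eqVlt; apply/orP; left; apply/eqP; rewrite /c /q; field.
by rewrite le_eqVlt; apply/orP; left; apply/eqP; rewrite /c /q; field.
Qed.

End KneserSpectrum.

(** * Modularity of subgraphs of the Kneser graph *)

Section PartitionedEdges.
Variable V : finType.
Implicit Types (E H : {set {set V}}) (P : {set {set V}}).

Lemma sum_degree E : (forall e, e \in E -> #|e| = 2%N) ->
  (\sum_v degree E v = 2 * #|E|)%N.
Proof.
move=> E2.
transitivity (\sum_(v : V) \sum_(e in E) (v \in e : nat))%N.
  apply: eq_bigr => v _; rewrite /degree -sum1_card big_mkcond [RHS]big_mkcond.
  by apply: eq_bigr => e _; rewrite inE; case: (e \in E); case: (v \in e).
rewrite exchange_big mulnC -sum_nat_const; apply: eq_bigr => e eE.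
by rewrite -(E2 e eE) -sum1_card [RHS]big_mkcond; apply: eq_bigr => v _; case: (v \in e).
Qed.

(** Blocks are disjoint, so a nonempty edge lies in at most one of them. *)
Lemma sum_edges_within P H : partition P [set: V] ->
  (forall e, e \in H -> e != set0) ->
  (\sum_(A in P) #|edges_within H A|
   = #|[set e in H | [exists A in P, e \subset A]]|)%N.
Proof.
move=> /and3P[_ /trivIsetP triv _] H0.
transitivity (\sum_(e in H) \sum_(A in P) (e \subset A : nat))%N.
  rewrite exchange_big; apply: eq_bigr => A _.
  rewrite -sum1_card big_mkcond [RHS]big_mkcond.
  by apply: eq_bigr => e _; rewrite inE; case: (e \in H); case: (e \subset A).
rewrite -sum1_card big_mkcond [RHS]big_mkcond; apply: eq_bigr => e _.
rewrite inE; case: ifP => //= eH.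
case: ifPn => [/existsP[A /andP[AP eA]]|/existsPn nP].
  rewrite (bigD1 A) //= eA big1 ?addn0 // => B /andP[BP BA].
  apply/eqP; rewrite eqb0; apply/negP => eB.
  have [v ve] := set0Pn _ (H0 e eH).
  have := triv _ _ BP AP BA => /disjointFr/(_ (subsetP eB v ve)).
  by rewrite (subsetP eA v ve).
by rewrite big1 // => A AP; have := nP A; rewrite AP /= => /negPf ->.
Qed.

Lemma modularity_le1 (R : realFieldType) E :
  (forall e, e \in E -> e != set0) -> modularity R E <= 1.
Proof.
move=> E0; have [P partP ->] := modularity_attained R E.
rewrite /partition_modularity -mulr_suml -natr_sum sum_edges_within //.
rewrite lerBlDr (@le_trans _ _ 1) //; last first.
  rewrite lerDl; apply: sumr_ge0 => A _; apply: divr_ge0; first exact: sqr_ge0.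
  by rewrite mulr_ge0 // sqr_ge0.
have [->|E_neq0] := eqVneq E set0; first by rewrite cards0 invr0 mulr0.
rewrite ler_pdivrMr ?ltr0n ?card_gt0 // mul1r ler_nat subset_leq_card //.
by apply/subsetP => e; rewrite inE => /andP[].
Qed.

End PartitionedEdges.

(** [X] is the covered fraction of edges, [Y] the degree tax, [b] the number of edges over its mean,
    [s] the normalised square sum of block sizes. Returning to the ideal values [s + rho * (1 - s)]
    and [s] costs at most [4 * eps] each. *)
Lemma modularity_arith (R : realFieldType) (rho s eps b X Y : R) :
  0 <= s <= 1 -> 0 <= rho <= 1 -> 0 < eps <= 1 / 2 ->
  1 - eps <= b <= 1 + eps ->
  X <= (s + rho * (1 - s) + eps) / b -> ((1 - eps) / b) ^+ 2 * s <= Y ->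
  X - Y <= rho + 8 * eps.
Proof.
move=> /andP[s0 s1] /andP[rho0 rho1] /andP[e0 e1] /andP[b0 b1] hX hY.
have b_gt0 : 0 < b by lra.
have hinv : b^-1 <= 1 + 2 * eps.
  rewrite -[b^-1]mul1r ler_pdivrMr //.
  apply: le_trans (_ : (1 + 2 * eps) * (1 - eps) <= _); first by nra.
  by rewrite ler_pM2l //; lra.
have hsq : 1 - 2 * eps <= (1 - eps) / b.
  rewrite ler_pdivlMr //.
  apply: (@le_trans _ _ ((1 - 2 * eps) * (1 + eps))); last by nra.
  by rewrite ler_wpM2l //; lra.
have hY' : (1 - 4 * eps) * s <= Y.
  apply: le_trans hY; rewrite ler_wpM2r //.
  apply: (@le_trans _ _ ((1 - 2 * eps) ^+ 2)); first by nra.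
  by rewrite lerXn2r // nnegrE; lra.
have hm : 0 <= s + rho * (1 - s) + eps by nra.
have hX' : X <= (s + rho * (1 - s) + eps) * (1 + 2 * eps).
  by apply: le_trans hX _; rewrite ler_wpM2l.
have h1 : s + rho * (1 - s) <= 1 by nra.
have h2 : (s + rho * (1 - s)) * eps <= eps by nra.
have h3 : rho * (1 - s) <= rho by nra.
have h4 : s * eps <= eps by nra.
have h5 : eps * eps <= eps / 2 by nra.
lra.
Qed.

(** * Edge and degree counts in the Kneser graph *)

Section KneserEdges.
Variables (n r : nat).
Hypothesis r_gt0 : (0 < r)%N.
Local Notation V := (johnson_vertex n r).
Local Notation E := (johnson_edges n r 0).
Implicit Types (u v : V) (A : {set V}).

Lemma johnson_adj_sym u v : johnson_adj 0 u v = johnson_adj 0 v u.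
Proof. by rewrite !kneser_adjE // disjoint_sym. Qed.

Lemma johnson_edgeP (e : {set V}) :
  reflect (exists u v, johnson_adj 0 u v /\ e = [set u; v]) (e \in E).
Proof.
rewrite inE; apply: (iffP existsP).
  by move=> [u /existsP[v /andP[uv /eqP ->]]]; exists u, v.
by move=> [u [v [uv ->]]]; exists u; apply/existsP; exists v; rewrite uv eqxx.
Qed.

Lemma card_johnson_edge (e : {set V}) : e \in E -> #|e| = 2%N.
Proof. by move=> /johnson_edgeP[u [v [/andP[uv _] ->]]]; rewrite cards2 uv. Qed.

Lemma johnson_edge_neq0 (e : {set V}) : e \in E -> e != set0.
Proof. by move=> /card_johnson_edge e2; rewrite -card_gt0 e2. Qed.

Lemma degree_edges_within A u :
  degree (edges_within E A) u
  = if u \in A then #|[set v in A | johnson_adj 0 u v]| else 0%N.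
Proof.
case: ifPn => uA; last first.
  apply/eqP; rewrite cards_eq0; apply/eqP/setP => e; rewrite !inE.
  apply/negbTE/negP => /andP[/andP[_ /subsetP eA] /eA ueA].
  by rewrite ueA in uA.
have inj : {in [set v in A | johnson_adj 0 u v] &, injective (fun v => [set u; v])}.
  move=> v w; rewrite !inE => /andP[_ /andP[uv _]] /andP[_ /andP[uw _]].
  by move=> /setP/(_ v); rewrite !inE eqxx orbT (eq_sym v u) (negPf uv) => /esym/eqP.
rewrite -(card_in_imset inj); apply: eq_card => e.
apply/idP/imsetP => [|[v]].
  rewrite !inE => /andP[/andP[+ eA] ue].
  move=> /existsP[x /existsP[y /andP[xy /eqP eE]]].
  move: ue eA; rewrite eE !inE subUset !sub1set => /orP[]/eqP ux /andP[xA yA].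
    by exists y; rewrite ?inE ux // yA.
  by exists x; rewrite ?inE ux 1?setUC // xA johnson_adj_sym.
rewrite inE => /andP[vA uv] ->.
rewrite !inE eqxx /= subUset !sub1set uA vA !andbT.
by apply/existsP; exists u; apply/existsP; exists v; rewrite uv eqxx.
Qed.

Lemma card_edges_within A :
  (2 * #|edges_within E A| = \sum_(u in A) \sum_(v in A) johnson_adj 0 u v)%N.
Proof.
rewrite -sum_degree => [|e]; last by rewrite inE => /andP[/card_johnson_edge].
rewrite [RHS]big_mkcond; apply: eq_bigr => u _; rewrite degree_edges_within.
case: ifP => // _; rewrite -sum1_card big_mkcond [RHS]big_mkcond.
by apply: eq_bigr => v _; rewrite inE; case: (v \in A); case: (johnson_adj _ _ _).
Qed.

Lemma edges_withinT (G : {set {set V}}) : edges_within G [set: V] = G.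
Proof. by apply/setP => e; rewrite inE subsetT andbT. Qed.

Lemma degree_kneser u : degree E u = kneser_degree n r.
Proof.
rewrite -[E]edges_withinT degree_edges_within inE /kneser_degree.
have := @card_disjoint_above n r u set0.
rewrite cards0 !subn0 => <- //; last by rewrite -setI_eq0 set0I.
by apply: eq_card => v; rewrite !inE kneser_adjE // sub0set andbT.
Qed.

Lemma card_johnson_edges : (2 * #|E| = #|{: V}| * kneser_degree n r)%N.
Proof.
rewrite -sum_degree => [|e]; last exact: card_johnson_edge.
by under eq_bigr => u _ do rewrite degree_kneser; rewrite sum_nat_const.
Qed.

End KneserEdges.

Section KneserModularity.
Variables (R : realFieldType) (n r : nat).
Hypothesis r_gt0 : (0 < r)%N.
Hypothesis r2n : (2 * r <= n)%N.
Local Notation V := (johnson_vertex n r).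
Local Notation E := (johnson_edges n r 0).
Local Notation D := (kneser_degree n r).
Local Notation N := #|{: V}|.
Local Notation rho := (r%:R / (n%:R - r%:R) : R).

(** The absorption identity for binomial coefficients; it brings [rho] into the eigenvalue bound. *)
Lemma kneser_degree_ratio : 'C(n - r - 1, r - 1)%:R = D%:R * rho.
Proof.
have nr : (r <= n)%N by lia.
have h : (n%:R - r%:R : R) != 0.
  by rewrite -natrB // pnatr_eq0; lia.
apply: (mulIf h); rewrite mulrA divfK // -natrB // -!natrM; congr _%:R.
have := mul_bin_diag (n - r) r.-1; rewrite prednK // -!subn1 => h'.
by rewrite /kneser_degree mulnC h' mulnC.
Qed.

Lemma kneser_ratio_bounds : 0 <= rho <= 1.
Proof.
have h : (0 : R) < n%:R - r%:R by rewrite -natrB ?ltr0n; lia.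
by rewrite divr_ge0 ?(ltW h) //= ler_pdivrMr // mul1r -natrB ?ler_nat; lia.
Qed.

Lemma sum_kneser_edges_within (P : {set {set V}}) (s : R) :
  partition P [set: V] -> s = (\sum_(A in P) #|A|%:R ^+ 2) / N%:R ^+ 2 ->
  2 * (\sum_(A in P) #|edges_within E A|)%N%:R
  <= D%:R * N%:R * (s + rho * (1 - s)).
Proof.
move=> partP sE.
have N0 : (N%:R : R) != 0.
  by rewrite card_johnson_vertex pnatr_eq0 -lt0n bin_gt0; lia.
rewrite -natrM big_distrr /=.
under eq_bigr => A _ do rewrite card_edges_within //.
rewrite natr_sum.
have sumN : \sum_(A in P) #|A|%:R = N%:R :> R.
  by rewrite -natr_sum -cardsT (card_partition partP).
apply: (@le_trans _ _ (\sum_(A in P) (D%:R * (#|A|%:R ^+ 2 / N%:R)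
     + 'C(n - r - 1, r - 1)%:R * (#|A|%:R - #|A|%:R ^+ 2 / N%:R)))).
  apply: ler_sum => A _; apply: le_trans (kneser_edges_within R r_gt0 r2n A).
  by rewrite natr_sum; apply: ler_sum => u _; rewrite natr_sum.
rewrite big_split /= -!mulr_sumr sumrB -!mulr_suml sumN kneser_degree_ratio.
move: rho => q.
by rewrite le_eqVlt; apply/orP; left; apply/eqP; rewrite sE; field.
Qed.

(** The deterministic half: the degree bounds keep the tax large, the inner edge bounds keep the
    coverage small. *)
Lemma modularity_subgraph_le (G : {set {set V}}) (p eps : R) :
  G \subset E -> 0 < p -> 0 < eps <= 1 / 2 ->
  (forall v, (1 - eps) * (p * D%:R) <= (degree G v)%:R) ->
  (forall P, partition P [set: V] ->
    (\sum_(A in P) #|edges_within G A|)%N%:R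
    <= p * (\sum_(A in P) #|edges_within E A|)%N%:R
       + eps * (p * N%:R * D%:R / 2)) ->
  modularity R G <= rho + 8 * eps.
Proof.
move=> GE p0 eps01 degG withinG.
have [eps0 eps1] : 0 < eps /\ eps <= 1 / 2 by apply/andP.
have [P partP ->] := modularity_attained R G.
have G2 e : e \in G -> #|e| = 2%N.
  by move=> /(subsetP GE); exact: card_johnson_edge.
have N0 : (0 : R) < N%:R by rewrite card_johnson_vertex ltr0n bin_gt0; lia.
have D0 : (0 : R) < D%:R by rewrite ltr0n bin_gt0; lia.
(* [M / 2] equals [p * #|E|], the mean number of edges. *)
pose M := p * N%:R * D%:R.
have M0 : 0 < M by rewrite !mulr_gt0.
have EM : p * #|E|%:R = M / 2.
  have : 2 * #|E|%:R = N%:R * D%:R :> R.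
    by rewrite -!natrM card_johnson_edges.
  by move=> h; rewrite /M -[p * _ * _]mulrA -h; field.
have eG_ge : (1 - eps) * (M / 2) <= #|G|%:R.
  have : \sum_(v : V) (1 - eps) * (p * D%:R) <= \sum_v (degree G v)%:R :> R.
    by apply: ler_sum => v _; exact: degG.
  rewrite sumr_const -natr_sum sum_degree // natrM -mulr_natr.
  by rewrite /M; lra.
have eG_le : #|G|%:R <= (1 + eps) * (M / 2).
  (* In the one-block partition every edge is inner, so the hypothesis also bounds the total number
     of edges. *)
  have := withinG [set [set: V]].
  rewrite !big_set1 !edges_withinT EM mulrDl mul1r; apply.
  apply/and3P; split.
  - by rewrite /cover big_set1.
  - by apply/trivIsetP => A B; rewrite !inE => /eqP -> /eqP ->; rewrite eqxx.
  - rewrite inE eq_sym -card_gt0 cardsT.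
    by rewrite -(ltr0n R).
pose s : R := (\sum_(A in P) #|A|%:R ^+ 2) / N%:R ^+ 2.
have e0 : 0 < #|G|%:R :> R.
  by apply: lt_le_trans eG_ge; rewrite mulr_gt0 //; lra.
pose b := #|G|%:R / (M / 2).
have b0 : 0 < b by rewrite divr_gt0 // divr_gt0.
have bE : #|G|%:R = b * (M / 2) by rewrite /b divfK // gt_eqF // divr_gt0.
have b01 : 1 - eps <= b <= 1 + eps.
  rewrite /b ler_pdivlMr ?divr_gt0 // ler_pdivrMr ?divr_gt0 //.
  by rewrite eG_ge eG_le.
clearbody b.
have s01 : 0 <= s <= 1.
  rewrite divr_ge0 ?sqr_ge0 ?sumr_ge0 //= => [|A _]; last exact: sqr_ge0.
  rewrite ler_pdivrMr ?exprn_gt0 // mul1r.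
  have sumN : \sum_(A in P) #|A|%:R = N%:R :> R.
    by rewrite -natr_sum -cardsT (card_partition partP).
  rewrite [X in _ <= X]expr2 -{1}sumN mulr_suml; apply: ler_sum => A _.
  by rewrite expr2 ler_wpM2l // ler_nat max_card.
rewrite /partition_modularity.
apply: (modularity_arith s01 kneser_ratio_bounds eps01 b01).
- rewrite -mulr_suml -natr_sum ler_pdivrMr //.
  apply: le_trans (withinG P partP) _.
  have -> : (s + rho * (1 - s) + eps) / b * #|G|%:R
      = (s + rho * (1 - s) + eps) * (M / 2) by rewrite bE [LHS]mulrA divfK // gt_eqF.
  rewrite -[_ * D%:R]/M [X in _ <= X]mulrDl lerD2r.
  have -> : (s + rho * (1 - s)) * (M / 2)
      = p * ((D%:R * N%:R * (s + rho * (1 - s))) / 2) by rewrite /M; ring.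
  rewrite ler_pM2l // ler_pdivlMr // mulrC.
  exact: sum_kneser_edges_within.
- have -> : ((1 - eps) / b) ^+ 2 * s
      = \sum_(A in P) (((1 - eps) * (p * D%:R)) * #|A|%:R) ^+ 2
                      / (4 * #|G|%:R ^+ 2).
    rewrite -mulr_suml; under eq_bigr => A _ do rewrite exprMn.
    rewrite -mulr_sumr bE /s /M.
    by field; rewrite ?gt_eqF.
  apply: ler_sum => A _; rewrite ler_wpM2r //.
    by rewrite invr_ge0 mulr_ge0 // sqr_ge0.
  have h0 : 0 <= (1 - eps) * (p * D%:R) * #|A|%:R.
    apply: mulr_ge0 => //; apply: mulr_ge0; first by lra.
    exact/ltW/mulr_gt0.
  have h1 : (1 - eps) * (p * D%:R) * #|A|%:R <= \sum_(v in A) (degree G v)%:R.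
    rewrite mulr_natr -sumr_const; apply: ler_sum => v _; exact: degG.
  by rewrite lerXn2r // nnegrE // (le_trans h0).
Qed.

End KneserModularity.

(** * Concentration *)

Section RandomSubset.
Variables (R : realFieldType) (I : finType) (E : {set I}) (p : R).
Variable mu : {set I} -> R.
Hypothesis mu_ge0 : forall H, 0 <= mu H.
Hypothesis mu_superset : forall J : {set I}, J \subset E ->
  \sum_(H : {set I} | J \subset H) mu H = p ^+ #|J|.

(** Expanding the power over subsets [J] of [F] leaves the inclusion weights [p ^+ #|J|], which
    refold into the binomial moment generating function. *)
Lemma random_subset_mgf (F : {set I}) (t : R) : F \subset E ->
  \sum_(H : {set I}) mu H * (1 + t) ^+ #|H :&: F| = (1 + t * p) ^+ #|F|.
Proof.
move=> FE.
transitivity (\sum_(H : {set I}) \sum_(J : {set I} | J \subset F)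
    t ^+ #|J| * (mu H * (J \subset H)%:R)).
  apply: eq_bigr => H _.
  have -> : (1 + t) ^+ #|H :&: F| = \prod_(i in F) (1 + t * (i \in H)%:R).
    rewrite -prodr_const big_mkcond [RHS]big_mkcond; apply: eq_bigr => i _.
    by rewrite inE; case: (i \in F); case: (i \in H); rewrite ?mulr1 ?mulr0 ?addr0.
  rewrite prod_indicator_expand mulr_sumr; apply: eq_bigr => J _; ring.
rewrite exchange_big /= -prodr_const.
have -> : \prod_(i in F) (1 + t * p) = \prod_(i in F) (1 + t * p * (i \in F)%:R).
  by apply: eq_bigr => i ->; rewrite mulr1.
rewrite prod_indicator_expand; apply: eq_bigr => J JF; rewrite JF mulr1 exprMn.
rewrite -mulr_sumr -mu_superset ?(subset_trans JF) //; congr (_ * _).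
rewrite [RHS]big_mkcond; apply: eq_bigr => H _.
by case: (J \subset H); rewrite ?mulr1 ?mulr0.
Qed.

Lemma sum_exists_le (K : finType) (Q : K -> pred {set I}) :
  \sum_(H : {set I} | [exists k, Q k H]) mu H
  <= \sum_k \sum_(H : {set I} | Q k H) mu H.
Proof.
under [leRHS]eq_bigr => k _ do rewrite big_mkcond.
rewrite exchange_big big_mkcond /=; apply: ler_sum => H _.
case: ifPn => [/existsP[k QkH]|_]; last by apply: sumr_ge0 => k _; case: ifP.
rewrite (bigD1 k) //= QkH lerDl.
by apply: sumr_ge0 => j _; case: ifP.
Qed.

End RandomSubset.

(** * Partitions as vertex colourings *)

Section PartitionFunction.
Variable V : finType.

Definition monochromatic (f : {ffun V -> V}) (e : {set V}) : bool :=
  [forall u in e, forall v in e, f u == f v].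

(** Each vertex is coloured by a representative of its block, so a union bound over partitions can
    run over the finite function type. *)
Lemma partition_coloring (P : {set {set V}}) : partition P [set: V] ->
  exists f : {ffun V -> V}, forall e : {set V}, e != set0 ->
    [exists A in P, e \subset A] = monochromatic f e.
Proof.
move=> partP; have /and3P[/eqP covP trivP _] := partP.
have inP v : v \in cover P by rewrite covP inE.
(* The pick depends only on the block; the default [v] never occurs, as a vertex lies in its own
   block. *)
exists [ffun v => odflt v [pick x in pblock P v]] => e /set0Pn[u ue].
have fP v : [ffun v => odflt v [pick x in pblock P v]] v \in pblock P v.
  by rewrite ffunE; case: pickP => [//|/(_ v)]; rewrite mem_pblock inP.
apply/existsP/forall_inP => [[A /andP[AP /subsetP eA]] v ve|mono].
  apply/forall_inP => w we; rewrite !ffunE.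
  have -> : pblock P v = A by exact: def_pblock (eA v ve).
  have -> : pblock P w = A by exact: def_pblock (eA w we).
  case: pickP => [//|/(_ v)]; by rewrite eA.
exists (pblock P u); rewrite pblock_mem //=; apply/subsetP => v ve.
have /forall_inP/(_ v ve)/eqP fuv := mono u ue.
have := fP u; rewrite fuv => fv.
rewrite -(same_pblock trivP fv) (same_pblock trivP (fP v)).
by rewrite mem_pblock.
Qed.

End PartitionFunction.

Section GoodSubgraph.
Variables (R : realFieldType) (n r : nat) (p eps : R).
Local Notation V := (johnson_vertex n r).
Local Notation E := (johnson_edges n r 0).
Local Notation D := (kneser_degree n r).
Local Notation N := #|{: V}|.

Definition color_edges (f : {ffun V -> V}) : {set {set V}} :=
  [set e in E | monochromatic f e].

Definition star (v : V) : {set {set V}} := [set e in E | v \in e].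

Lemma color_edges_sub f : color_edges f \subset E.
Proof. by apply/subsetP => e; rewrite inE => /andP[]. Qed.

Lemma star_sub v : star v \subset E.
Proof. by apply/subsetP => e; rewrite inE => /andP[]. Qed.

(** The allowed excess is relative to all of [E], not to [color_edges f]: the tail exponent is then
    of order [p * #|E|] for every [f], enough to beat the number of colourings. *)
Definition crowded (f : {ffun V -> V}) (H : {set {set V}}) : bool :=
  p * #|color_edges f|%:R + eps * (p * #|E|%:R) < #|H :&: color_edges f|%:R.

Definition sparse_at (v : V) (H : {set {set V}}) : bool :=
  #|H :&: star v|%:R < (1 - eps) * (p * #|star v|%:R).

Definition bad_subgraph (H : {set {set V}}) : bool :=
  [exists f, crowded f H] || [exists v, sparse_at v H].

Lemma modularity_not_bad (H : {set {set V}}) :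
  (0 < r)%N -> (2 * r <= n)%N -> 0 < p -> 0 < eps <= 1 / 2 ->
  H \subset E -> ~~ bad_subgraph H ->
  modularity R H <= r%:R / (n%:R - r%:R) + 8 * eps.
Proof.
move=> r0 r2n p0 eps01 HE; rewrite negb_or => /andP[/existsPn fH /existsPn vH].
have H0 e : e \in H -> e != set0.
  by move=> /(subsetP HE); exact: johnson_edge_neq0.
have E0 (e : {set V}) : e \in E -> e != set0 by exact: johnson_edge_neq0.
apply: (modularity_subgraph_le r0 r2n HE p0 eps01).
  move=> v; have := vH v; rewrite -leNgt.
  have -> : #|H :&: star v| = degree H v.
    apply: eq_card => e; rewrite in_setI [e \in star v]inE [RHS]inE.
    by case: (boolP (e \in H)) => //= eH; rewrite (subsetP HE).
  by rewrite -(degree_kneser r0 v).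
move=> P partP; have [f fP] := partition_coloring partP.
rewrite !sum_edges_within //.
have -> : #|[set e in E | [exists A in P, e \subset A]]| = #|color_edges f|.
  apply: eq_card => e; rewrite inE [RHS]inE.
  by case: (boolP (e \in E)) => //= eE; rewrite fP // E0.
have -> : #|[set e in H | [exists A in P, e \subset A]]| = #|H :&: color_edges f|.
  apply: eq_card => e; rewrite [LHS]inE in_setI [e \in color_edges f]inE.
  by case: (boolP (e \in H)) => //= eH; rewrite fP ?H0 // (subsetP HE).
have := fH f; rewrite -leNgt /crowded => /le_trans; apply.
have : 2 * #|E|%:R = N%:R * D%:R :> R by rewrite -!natrM card_johnson_edges.
by move=> h; rewrite -[p * N%:R * D%:R]mulrA -h; lra.
Qed.

End GoodSubgraph.

From mathcomp Require Import all_classical all_reals all_analysis.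
Import Order.TTheory GRing.Theory Num.Theory.
Import numFieldNormedType.Exports.

(** Inverting [1 - u <= expR (- u)] reduces this to [(1 + u + 2 * u ^+ 2) * (1 - u) = 1 + u ^+ 2 *
    (1 - 2 * u)], which is at least 1. *)
Lemma expR_le_quadratic (R : realType) (u : R) : `|u| <= 1 / 2 ->
  expR u <= 1 + u + 2 * u ^+ 2.
Proof.
rewrite ler_norml => /andP[u0 u1].
have h : 1 - u <= expR (- u) by have := expR_ge1Dx (- u).
have e0 := expR_gt0 (- u).
rewrite -[u in expR u]opprK expRN -[X in X <= _]mul1r ler_pdivrMr //.
apply: le_trans (_ : (1 + u + 2 * u ^+ 2) * (1 - u) <= _).
  have : 0 <= u ^+ 2 * (1 - 2 * u) by rewrite mulr_ge0 ?sqr_ge0 //; lra.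
  by rewrite !expr2; lra.
rewrite ler_wpM2l //.
have : 0 <= u ^+ 2 by exact: sqr_ge0.
by lra.
Qed.

Section Chernoff.
Variables (R : realType) (I : finType) (E : {set I}) (p eps : R).
Variable mu : {set I} -> R.
Hypothesis p01 : 0 <= p <= 1.
Hypothesis eps01 : 0 < eps <= 1 / 2.
Hypothesis mu_ge0 : forall H, 0 <= mu H.
Hypothesis mu_superset : forall J : {set I}, J \subset E ->
  \sum_(H : {set I} | J \subset H) mu H = p ^+ #|J|.

(** Markov's inequality for [expR (u * #|H :&: F|%:R)], using the moment generating function at
    [t = expR u - 1]. Either sign of [u] is allowed, so both tails follow. *)
Lemma exponential_markov (F : {set I}) (u a : R) (Q : pred {set I}) :
  F \subset E -> `|u| <= 1 / 2 ->
  (forall H, Q H -> u * a <= u * #|H :&: F|%:R) ->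
  \sum_(H : {set I} | Q H) mu H
  <= expR (p * #|F|%:R * (u + 2 * u ^+ 2) - u * a).
Proof.
move=> FE u12 Qa; have [p0 p1] : 0 <= p /\ p <= 1 by apply/andP.
apply: (@le_trans _ _ (\sum_(H : {set I})
    mu H * (1 + (expR u - 1)) ^+ #|H :&: F| * expR (- (u * a)))).
  rewrite big_mkcond; apply: ler_sum => H _.
  rewrite addrC subrK -expRM_natl -mulrA -expRD; case: ifPn => [QH|_].
    rewrite ler_peMr // -[X in X <= _]expR0 ler_expR subr_ge0 [X in _ <= X]mulrC.
    exact: Qa.
  by rewrite mulr_ge0 // expR_ge0.
rewrite -mulr_suml (random_subset_mgf mu_superset) // expRD.
rewrite ler_wpM2r ?expR_ge0 //.
rewrite [p * _]mulrC -mulrA expRM_natl.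
have e0 := expR_ge0 u.
have base0 : 0 <= 1 + (expR u - 1) * p by nra.
rewrite lerXn2r // ?nnegrE ?expR_ge0 //.
apply: le_trans (expR_ge1Dx _); rewrite lerD2l mulrC ler_wpM2l //.
by have := expR_le_quadratic u12; lra.
Qed.

(** With [u = eps / 4] the quadratic term costs at most [eps ^+ 2 * (p * M) / 8], and the deviation
    gains twice that. *)
Lemma chernoff_upper (F : {set I}) (M : R) : F \subset E -> #|F|%:R <= M ->
  \sum_(H : {set I} | p * #|F|%:R + eps * (p * M) < #|H :&: F|%:R) mu H
  <= expR (- (eps ^+ 2 * (p * M) / 8)).
Proof.
move=> FE FM; have [p0 p1] : 0 <= p /\ p <= 1 by apply/andP.
have [e0 e1] : 0 < eps /\ eps <= 1 / 2 by apply/andP.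
pose a := p * #|F|%:R + eps * (p * M).
apply: (@le_trans _ _ (expR (p * #|F|%:R
    * (eps / 4 + 2 * (eps / 4) ^+ 2) - eps / 4 * a))).
  apply: exponential_markov => // [|H QH]; first by rewrite ger0_norm; lra.
  by rewrite ler_pM2l ?ltW //; lra.
rewrite ler_expR /a.
have : p * #|F|%:R * eps ^+ 2 <= p * M * eps ^+ 2.
  by rewrite ler_wpM2r ?sqr_ge0 // ler_wpM2l.
by rewrite !expr2; lra.
Qed.

Lemma chernoff_lower (F : {set I}) : F \subset E ->
  \sum_(H : {set I} | #|H :&: F|%:R < (1 - eps) * (p * #|F|%:R)) mu H
  <= expR (- (eps ^+ 2 * (p * #|F|%:R) / 8)).
Proof.
move=> FE; have [e0 e1] : 0 < eps /\ eps <= 1 / 2 by apply/andP.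
pose a := (1 - eps) * (p * #|F|%:R).
apply: (@le_trans _ _ (expR (p * #|F|%:R
    * (- (eps / 4) + 2 * (- (eps / 4)) ^+ 2) - - (eps / 4) * a))).
  apply: exponential_markov => // [|H QH].
    by rewrite normrN ger0_norm; lra.
  by rewrite !mulNr lerN2 ler_pM2l ?ltW //; lra.
by rewrite ler_expR /a !expr2; lra.
Qed.

End Chernoff.

Section BadSubgraph.
Variables (R : realType) (n r : nat) (p eps : R).
Local Notation V := (johnson_vertex n r).
Local Notation E := (johnson_edges n r 0).
Local Notation D := (kneser_degree n r).
Local Notation N := #|{: V}|.
Variable mu : {set {set V}} -> R.
Hypothesis r_gt0 : (0 < r)%N.
Hypothesis r2n : (2 * r <= n)%N.
Hypothesis p01 : 0 <= p <= 1.
Hypothesis eps01 : 0 < eps <= 1 / 2.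
Hypothesis mu_ge0 : forall H, 0 <= mu H.
Hypothesis mu_superset : forall J : {set {set V}}, J \subset E ->
  \sum_(H : {set {set V}} | J \subset H) mu H = p ^+ #|J|.

(** The constant 64 gives each of the [N ^ N] colourings a tail of at most [expR (- (4 * N * ln N))]
    and each of the [N] stars one of at most [N ^- 8]; either sum is at most [N ^- 2]. *)
Lemma bad_subgraph_prob_le : 64 * ln (N%:R : R) <= eps ^+ 2 * (p * D%:R) ->
  \sum_(H : {set {set V}} | bad_subgraph p eps H) mu H <= 2 / N%:R ^+ 2.
Proof.
move=> lnN.
have N1 : (1 <= N)%N by rewrite card_johnson_vertex bin_gt0; lia.
have N1R : 1 <= N%:R :> R by rewrite ler1n.
have N0 : 0 < N%:R :> R by lra.
have ln0 : 0 <= ln (N%:R : R) by exact: ln_ge0.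
have E2 : 2 * #|E|%:R = N%:R * D%:R :> R by rewrite -!natrM card_johnson_edges.
have pow k : N%:R ^+ k = expR (k%:R * ln (N%:R : R)).
  by rewrite expRM_natl lnK // posrE.
have target : N%:R ^- 2 = expR (- (2 * ln (N%:R : R))) by rewrite expRN -pow.
apply: (@le_trans _ _ (\sum_(H : {set {set V}} | [exists f, crowded p eps f H]) mu H
   + \sum_(H : {set {set V}} | [exists v, sparse_at p eps v H]) mu H)).
  rewrite [leLHS]big_mkcond [X in _ <= X + _]big_mkcond.
  rewrite [X in _ <= _ + X]big_mkcond -big_split; apply: ler_sum => H _ /=.
  rewrite /bad_subgraph; case: [exists f, _]; case: [exists v, _] => /=;
    rewrite ?addr0 ?add0r // lerDl mu_ge0 //.
rewrite mulr_natl mulr2n; apply: lerD.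
  apply: le_trans (sum_exists_le mu_ge0 _) _.
  apply: (@le_trans _ _ (\sum_(f : {ffun V -> V})
      expR (- (eps ^+ 2 * (p * #|E|%:R) / 8)))).
    apply: ler_sum => f _.
    apply: (chernoff_upper p01 eps01 mu_ge0 mu_superset (color_edges_sub f)).
    by rewrite ler_nat subset_leq_card // color_edges_sub.
  rewrite sumr_const card_ffun -[leLHS]mulr_natl natrX pow -expRD target ler_expR.
  have h : 64 * ln (N%:R : R) * N%:R <= eps ^+ 2 * (p * D%:R) * N%:R.
    by rewrite ler_wpM2r // ltW.
  have -> : eps ^+ 2 * (p * #|E|%:R) / 8 = eps ^+ 2 * (p * D%:R) * N%:R / 16.
    by have -> : #|E|%:R = N%:R * D%:R / 2 :> R by [rewrite -E2; field]; field.
  have : ln (N%:R : R) <= ln (N%:R : R) * N%:R by rewrite ler_peMr.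
  by lra.
apply: le_trans (sum_exists_le mu_ge0 _) _.
apply: (@le_trans _ _ (\sum_(v : V) expR (- (eps ^+ 2 * (p * D%:R) / 8)))).
  apply: ler_sum => v _.
  have SD : #|star v| = D by exact: degree_kneser.
  by have := chernoff_lower p01 eps01 mu_ge0 mu_superset (star_sub v); rewrite SD /sparse_at SD.
rewrite sumr_const -[leLHS]mulr_natl target [X in X * _ <= _](pow 1%N) mul1r -expRD ler_expR.
by lra.
Qed.

End BadSubgraph.

(** * Estimates of binomial coefficients *)

Lemma bin_ge_n (m k : nat) : (0 < k < m)%N -> (m <= 'C(m, k))%N.
Proof.
elim: m k => // m IH [//|k] /=; rewrite !ltnS => km; rewrite binS.
case: (ltngtP k.+1 m) => [km'|h|<-]; last 1 first.
- by rewrite binn; case: k km => [|k] km; rewrite ?bin0 // binSn.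
- by rewrite -[X in (X <= _)%N]addn1 leq_add ?IH // bin_gt0 ltnW.
- lia.
Qed.

(** Pascal's rule on both sides, with [bin_ge_n] for the lower terms; the base case [m = k.+2] is
    the symmetry of binomial coefficients. *)
Lemma bin_ge_bin2 (m k : nat) : (1 < k)%N -> (k.+2 <= m)%N ->
  ('C(m, 2) <= 'C(m, k))%N.
Proof.
elim: m k => // m IH k k1; rewrite ltnS leq_eqVlt => /predU1P[<-|km].
  by rewrite -(@bin_sub k.+2 2) // !subSS subn0.
case: k k1 km => // k k1 km; rewrite !binS bin1 leq_add ?IH //.
by rewrite bin_ge_n //; lia.
Qed.

Lemma bin_le_exp2 (m k : nat) : ('C(m, k) <= 2 ^ m)%N.
Proof.
elim: m k => [|m IH] [|k] //; first by rewrite bin0 expn_gt0.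
by rewrite binS expnS mul2n -addnn leq_add.
Qed.

(** For [r = 1], [ln n] is twice the logarithm of the square root. Otherwise ['C(n, r) <= 2 ^ n] and
    [n ^ 2 <= 16 * 'C(n - r, 2)] suffice; [2 * r + 2 <= n] is the range condition of
    [bin_ge_bin2]. *)
Lemma ln_bin_le (R : realType) (n r : nat) :
  (0 < r)%N -> (2 * r + 2 <= n)%N ->
  ln ('C(n, r)%:R : R) <= 4 * Num.sqrt ('C(n - r, r)%:R).
Proof.
move=> r0 rn.
have ln_lt (x : R) : 0 < x -> ln x <= x.
  move=> x0; have -> : x = 1 + (x - 1) by ring.
  by apply: le_trans (le_ln1Dx _) _; lra.
have [r1|r2] := leqP r 1.
  have -> : r = 1%N by apply/eqP; rewrite eqn_leq r1.
  rewrite !bin1; have n0 : 0 < n%:R :> R by rewrite ltr0n; lia.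
  have s0 : 0 < Num.sqrt (n%:R : R) by rewrite sqrtr_gt0.
  have -> : ln (n%:R : R) = ln (Num.sqrt n%:R) *+ 2.
    by rewrite -lnXn // sqr_sqrtr // ltW.
  apply: le_trans (_ : Num.sqrt n%:R *+ 2 <= _); first by rewrite lerMn2r ln_lt.
  have : Num.sqrt (n%:R : R) <= Num.sqrt (2 ^+ 2 * (n - 1)%:R).
    by rewrite ler_wsqrtr // -natrX -natrM ler_nat; lia.
  by rewrite sqrtrM // sqrtr_sqr ger0_norm // mulr2n; lra.
have ln_le : ln ('C(n, r)%:R : R) <= n%:R.
  rewrite -[leRHS]expRK ler_ln ?posrE ?expR_gt0 ?ltr0n ?bin_gt0 //; last by lia.
  rewrite -[n%:R]mulr1 expRM_natl.
  apply: (@le_trans _ _ (2 ^+ n)).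
    by rewrite -natrX ler_nat bin_le_exp2.
  rewrite lerXn2r // ?nnegrE ?expR_ge0 //.
  by have := @expR_ge1Dx R 1; lra.
apply: le_trans ln_le _.
rewrite -[n%:R](@ger0_norm R) // -sqrtr_sqr -[4](@ger0_norm R) // -sqrtr_sqr.
rewrite -sqrtrM ?sqr_ge0 // ler_wsqrtr // -!natrX -natrM ler_nat.
apply: (@leq_trans (4 ^ 2 * 'C(n - r, 2))); last first.
  by rewrite leq_mul2l bin_ge_bin2 //; lia.
have := mul_bin_diag (n - r) 1; rewrite bin1.
by nia.
Qed.

(** * Almost sure statements *)

Local Open Scope classical_set_scope.

(** The superior limit is an infimum of suprema over sets of the filter, and each such set may be
    cut down to the indices where the inequality with slack [e] holds. *)
Lemma limn_esup_le_approx (R : realType) (u v : nat -> \bar R) :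
  (forall e : R, 0 < e -> \forall n \near \oo, (u n <= v n + e%:E)%E) ->
  (limn_esup u <= limn_esup v)%E.
Proof.
move=> uv; apply: le_ereal_inf_tmp => _ [A FA <-].
apply/lee_addgt0Pr => e e0; apply: ge_ereal_inf.
pose B := A `&` [set n | (u n <= v n + e%:E)%E].
exists (ereal_sup (u @` B)).
  by exists B => //; apply: filterI => //; exact: uv.
apply: ge_ereal_sup => _ [n [An /= un] <-]; apply: le_trans un _.
by apply: leeD2r; apply: ereal_sup_ubound; exists n.
Qed.

(** The bounds are [C] times differences of consecutive reciprocals, so they telescope to a total of
    at most [C]. *)
Lemma borel_cantelli_inv_square d (T : measurableType d) (R : realType)
    (P : probability T R) (F : nat -> set T) (C : R) :
  (forall n, measurable (F n)) ->
  (forall n, (P (F n) <= (C / (n.+1%:R * n.+2%:R))%:E)%E) ->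
  {ae P, forall w, \forall n \near \oo, ~ F n w}.
Proof.
move=> mF PF.
have C0 : 0 <= C.
  have := le_trans (measure_ge0 P (F 0%N)) (PF 0%N).
  by rewrite lee_fin pmulr_lge0 // invr_gt0 mulr_gt0.
have : P (lim_sup_set F) = 0%E.
  apply: lim_sup_set_cvg0 => //; apply: le_lt_trans (ltry C).
  apply: lime_le; first by apply: is_cvg_nneseries => n _ _; exact: measure_ge0.
  apply: nearW => n.
  apply: (@le_trans _ _ (C * (1 - n.+1%:R^-1))%:E); last first.
    by rewrite lee_fin ler_piMr // gerBl invr_ge0.
  elim: n => [|n IH]; first by rewrite big_geq // lee_fin invr1 subrr mulr0.
  rewrite big_nat_recr //=; apply: le_trans (leeD IH (PF n)) _.
  rewrite -EFinD lee_fin le_eqVlt; apply/orP; left; apply/eqP.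
  have x0 : 0 < n.+1%:R :> R by [].
  have -> : n.+2%:R = n.+1%:R + 1 :> R by rewrite -addn1 natrD.
  move: (n.+1%:R : R) x0 => x x0.
  by field; rewrite !gt_eqF //; lra.
move=> F0; exists (lim_sup_set F); split => //.
  by apply: bigcapT_measurable => n; apply: bigcup_measurable.
move=> w /= Fw n _; apply: contrapT => nF; apply: Fw.
exists n => // m /= nm Fm; apply: nF; by exists m.
Qed.

(** * The law of the random edge set *)

Section RandomGraphLaw.
Context d (T : measurableType d) (R : realType) (P : probability T R).
Variables (V : finType) (E : {set {set V}}) (p : R) (G : T -> {set {set V}}).
Hypothesis hG : is_random_subgraph P E p G.

Definition graph_law (H : {set {set V}}) : R := fine (P [set w | G w = H]).

Lemma measurable_graph_mem e : measurable [set w | e \in G w].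
Proof.
case: hG => GE mG _ _; have [eE|eE] := boolP (e \in E); first exact: mG.
rewrite (_ : [set w | _] = set0); first exact: measurable0.
rewrite -subset0 => w /= eG; move/negP: eE; apply.
exact: (fintype.subsetP (GE w)).
Qed.

Lemma measurable_graph_eq H : measurable [set w | G w = H].
Proof.
rewrite (_ : [set w | _] = \bigcap_(e in setT)
    (if e \in H then [set w | e \in G w] else ~` [set w | e \in G w])).
  apply: fin_bigcap_measurable => // e _; have me := measurable_graph_mem e.
  by case: ifP => // _; exact: measurableC.
apply/seteqP; split => [w /= GH e _|w wH /=].
  by rewrite -GH; case: ifPn => //= /negP.
apply/setP => e; have := wH e Logic.I.
by case: ifP => _ /= => [->|/negP/negPf].
Qed.

Lemma graph_eventE (Q : pred {set {set V}}) :
  [set w | Q (G w)] = \bigcup_(H in [set` Q]) [set w | G w = H].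
Proof.
apply/seteqP; split => [w /= QG|w [H /= QH GH]]; first by exists (G w).
by rewrite GH.
Qed.

Lemma measurable_graph_event (Q : pred {set {set V}}) :
  measurable [set w | Q (G w)].
Proof.
rewrite graph_eventE; apply: fin_bigcup_measurable => // H _.
exact: measurable_graph_eq.
Qed.

Lemma graph_law_ge0 H : 0 <= graph_law H.
Proof. by rewrite fine_ge0. Qed.

Lemma prob_graph_event (Q : pred {set {set V}}) :
  P [set w | Q (G w)] = (\sum_(H : {set {set V}} | Q H) graph_law H)%:E.
Proof.
rewrite graph_eventE measure_fin_bigcup //.
- rewrite -(@bigfs _ _ _ _ (index_enum _)) ?index_enum_uniq //; last first.
    by move=> H _; rewrite mem_index_enum.
  rewrite -sumEFin; apply: eq_bigr => H _; rewrite fineK //.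
  exact/fin_num_measure/measurable_graph_eq.
- by move=> H K _ _ [w [/= <- <-]].
- by move=> H _; exact: measurable_graph_eq.
Qed.

(** Mutual independence turns [graph_law] into an instance of the weight [mu] of the concentration
    bounds. *)
Lemma graph_law_superset (J : {set {set V}}) : J \subset E ->
  \sum_(H : {set {set V}} | J \subset H) graph_law H = p ^+ #|J|.
Proof.
case: hG => _ _ Pp indep JE; apply: EFin_inj.
rewrite -(prob_graph_event (fun H => J \subset H)).
have -> : [set w | J \subset G w] = [set w | forall e, e \in J -> e \in G w].
  by apply/seteqP; split => w /= => [/fintype.subsetP|] // JG; exact/fintype.subsetP.
rewrite indep // -prodr_const -prodEFin; apply: eq_bigr => e eJ.
by rewrite Pp // (fintype.subsetP JE).
Qed.

End RandomGraphLaw.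

(** By [ln_bin_le] it suffices that [p n] times the square root of the degree eventually reaches
    [4 * K]; this also forces [p n] to be positive. *)
Lemma little_omega_degree (R : realType) (r : nat -> nat) (p : nat -> R) (K : R) :
  (forall n : nat, (2 <= n)%N -> (1 <= r n)%N /\ (2 * r n <= n)%N) ->
  little_omega p (fun n : nat => 'C(n - r n, r n)%:R `^ (- (1 / 2))) ->
  0 < K ->
  \forall n \near \oo, (2 * r n + 2 <= n)%N ->
    0 < p n /\ K * ln ('C(n, r n)%:R : R) <= p n * 'C(n - r n, r n)%:R.
Proof.
move=> hr /cvgryPge/(_ (4 * K)) hp K0; near=> n => rn.
have [r1 r2] : (1 <= r n)%N /\ (2 * r n <= n)%N by apply: hr; near: n; exists 2%N.
set D : R := 'C(n - r n, r n)%:R.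
have D0 : 0 < D by rewrite ltr0n bin_gt0; lia.
have s0 : 0 < Num.sqrt D by rewrite sqrtr_gt0.
have : 4 * K <= p n * Num.sqrt D.
  have -> : p n * Num.sqrt D = p n / D `^ (- (1 / 2)).
    by rewrite powRN invrK div1r powR12_sqrt // ltW.
  by rewrite /D; near: n; exact: hp.
move=> h; split.
  by rewrite -(pmulr_lgt0 _ s0); apply: lt_le_trans h; rewrite mulr_gt0.
apply: le_trans (_ : K * (4 * Num.sqrt D) <= _).
  by rewrite ler_pM2l // ln_bin_le.
rewrite -[D in leRHS]sqr_sqrtr; last exact: ltW.
rewrite expr2 !mulrA ler_pM2r //.
by rewrite [K * 4]mulrC.
Unshelve. all: by end_near. Qed.

Section AlmostSureBound.
Variables (R : realType) (d : measure_display) (T : measurableType d).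
Variables (P : probability T R) (r : nat -> nat) (p : nat -> R).
Hypothesis hr : forall n : nat, (2 <= n)%N -> (1 <= r n)%N /\ (2 * r n <= n)%N.
Hypothesis hp01 : forall n : nat, (2 <= n)%N -> 0 <= p n <= 1.
Hypothesis hp :
  little_omega p (fun n : nat => 'C(n - r n, r n)%:R `^ (- (1 / 2))).
Variable G : forall n : nat, T -> {set {set johnson_vertex n (r n)}}.
Hypothesis hG : forall n : nat, (2 <= n)%N ->
  is_random_subgraph P (johnson_edges n (r n) 0) (p n) (G n).

(* When [n <= 2r + 1] the trivial bound [1] on the modularity is already within
   [2 / (n + 1)] of [r / (n - r)], so no concentration is needed there. *)
Lemma kneser_ratio_near1 (n k : nat) : (0 < k)%N -> (2 * k <= n)%N ->
  (n < 2 * k + 2)%N -> (1 : R) <= k%:R / (n%:R - k%:R) + 2 / n.+1%:R.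
Proof.
move=> k0 kn nk.
have h : n%:R <= 2 * k%:R + 1 :> R by rewrite -natrM natr1 ler_nat; lia.
have h' : 2 * k%:R <= n%:R :> R by rewrite -natrM ler_nat.
have k0' : 0 < k%:R :> R by rewrite ltr0n.
rewrite -[n.+1%:R]natr1 -subr_ge0.
move: (n%:R : R) (k%:R : R) h h' k0' => x y h h' y0.
have -> : y / (x - y) + 2 / (x + 1) - 1
    = ((x + 1) * (2 * y - x) + 2 * (x - y)) / ((x - y) * (x + 1)).
  by field; rewrite !gt_eqF //; lra.
by rewrite divr_ge0 // ?mulr_ge0 //; nra.
Qed.

Lemma modularity_near_le (eps : R) : 0 < eps <= 1 / 2 ->
  {ae P, forall w, \forall n \near \oo,
    modularity R (G n w) <= (r n)%:R / (n%:R - (r n)%:R) + 8 * eps}.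
Proof.
move=> eps01; have [e0 e1] : 0 < eps /\ eps <= 1 / 2 by apply/andP.
have K0 : 0 < 64 / eps ^+ 2 by rewrite divr_gt0 // exprn_gt0.
have [n0 _ hn0] := little_omega_degree hr hp K0.
pose active n := [&& 2 <= n, n0 <= n & 2 * r n + 2 <= n]%N.
(* Indices without a tail bound get the empty event, so Borel-Cantelli can run over all [n]. *)
pose F n := if active n then [set w | bad_subgraph (p n) eps (G n w)] else set0.
have mF n : measurable (F n).
  rewrite /F; case: ifPn => [/and3P[n2 _ _]|_] //.
  exact: measurable_graph_event (hG n2) _.
(* The tail is at most [2 / n ^ 2] because [n <= N]; the 6 comes from
   [(n + 1) * (n + 2) <= 3 * n ^ 2], an equality at [n = 2]. *)
have PF n : (P (F n) <= (6 / (n.+1%:R * n.+2%:R))%:E)%E.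
  rewrite /F; case: ifPn => [/and3P[n2 nn0 rn]|_]; last first.
    by rewrite measure0 lee_fin divr_ge0.
  have [r1 r2n] := hr n2.
  have [p0 pK] := hn0 n nn0 rn.
  rewrite (prob_graph_event (hG n2)) lee_fin.
  apply: le_trans (bad_subgraph_prob_le r1 r2n (hp01 n2) eps01
    (graph_law_ge0 P (G n)) (graph_law_superset (hG n2)) _) _.
    rewrite card_johnson_vertex; move: pK.
    by rewrite mulrAC ler_pdivrMr ?exprn_gt0 // [leRHS]mulrC.
  have nN : (n <= #|{: johnson_vertex n (r n)}|)%N.
    by rewrite card_johnson_vertex bin_ge_n //; lia.
  have n0R : 0 < n%:R :> R by rewrite ltr0n; lia.
  have N0R : 0 < #|{: johnson_vertex n (r n)}|%:R :> R.
    by apply: lt_le_trans n0R _; rewrite ler_nat.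
  apply: (@le_trans _ _ (2 / n%:R ^+ 2)).
    rewrite ler_pM2l // lef_pV2 ?posrE ?exprn_gt0 //.
    by rewrite lerXn2r ?nnegrE // ler_nat.
  rewrite ler_pdivlMr ?mulr_gt0 // mulrAC ler_pdivrMr ?exprn_gt0 //.
  by rewrite -natrX -!natrM ler_nat; nia.
apply: filterS (borel_cantelli_inv_square mF PF) => w /= nearF.
near=> n.
have n2 : (2 <= n)%N by near: n; exists 2%N.
have nn0 : (n0 <= n)%N by near: n; exists n0.
have [r1 r2n] := hr n2.
have GE w' : G n w' \subset johnson_edges n (r n) 0 by case: (hG n2).
have [rn|rn] := leqP (2 * r n + 2) n.
  have [p0 _] := hn0 n nn0 rn.
  apply: (modularity_not_bad r1 r2n p0 eps01 (GE w)).
  apply/negP => bad.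
  have : ~ F n w by near: n.
  by apply; rewrite /F /active n2 nn0 rn.
apply: (@le_trans _ _ 1).
  apply: modularity_le1 => e eG; apply: johnson_edge_neq0.
  exact: (fintype.subsetP (GE w)).
apply: le_trans (kneser_ratio_near1 r1 r2n rn) _; rewrite lerD2l.
(* This makes the error [2 / n.+1] smaller than [8 * eps]. *)
have neps : 1 / eps <= n%:R by near: n; exact: nbhs_infty_ger.
rewrite ler_pdivrMr // -natr1.
by move: neps; rewrite ler_pdivrMr // => neps; nra.
Unshelve. all: by end_near. Qed.

End AlmostSureBound.

Theorem theorem3p8 (R : realType) (d : measure_display)
  (T : measurableType d) (P : probability T R)
  (r : nat -> nat) (p : nat -> R)
  (hr : forall n : nat, (2 <= n)%N -> (1 <= r n)%N /\ (2 * r n <= n)%N)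
  (hp01 : forall n : nat, (2 <= n)%N -> 0 <= p n <= 1)
  (hp : little_omega p (fun n : nat => 'C(n - r n, r n)%:R `^ (- (1 / 2))))
  (G : forall n : nat, T -> {set {set johnson_vertex n (r n)}})
  (hG : forall n : nat, (2 <= n)%N ->
    is_random_subgraph P (johnson_edges n (r n) 0) (p n) (G n)) :
  {ae P, forall w,
    (limn_esup (fun n : nat => (modularity R (G n w))%:E)
     <= limn_esup (fun n : nat => ((r n)%:R / (n%:R - (r n)%:R) : R)%:E))%E}.
Proof.
(* Null sets can be merged only countably often, so [eps] runs through [1 / (k + 2)], all at most
   [1 / 2]. *)
have eps01 (k : nat) : 0 < (k.+2%:R^-1 : R) <= 1 / 2.
  by rewrite invr_gt0 ltr0n /= div1r lef_pV2 ?posrE ?ltr0n // ler_nat.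
have := ae_foralln (fun k => modularity_near_le hr hp01 hp hG (eps01 k)).
apply: filterS => w /= near_w; apply: limn_esup_le_approx => e e0.
pose k := Num.bound (8 / e).
have ke : 8 * k.+2%:R^-1 <= e.
  rewrite ler_pdivrMr // mulrC -ler_pdivrMr //.
  apply: ltW; apply: lt_trans (archi_boundP _) _; first by rewrite divr_ge0 // ltW.
  by rewrite ltr_nat.
apply: filterS (near_w k) => n; rewrite -EFinD lee_fin => /le_trans; apply.
by rewrite lerD2l.
Qed.
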